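(* Let $n\ge 6$ be an even integer, and let $r=\min\{|w-1| : w\in\mathbb{C},\ w^n=1,\ \mathrm{Im}(w)>0\}$. Let $\zeta=a+ib$ (with $a,b\in\mathbb{R}$) be the $n$th root of unity satisfying $0<a<1$, $0<b<1$ and $|\zeta-1|=r$. Then $\zeta$ is a primitive $n$th root of unity.
   Context: An $n$th root of unity is a complex number $w$ with $w^n=1$; there are exactly $n$ distinct ones. An $n$th root of unity $w$ is called a primitive $n$th root of unity if $w,w^2,\ldots,w^n=1$ are all the $n$ $n$th roots of unity. For even $n\ge 6$, an $n$th root of unity $\zeta=a+ib$ with $0<a<1$, $0<b<1$ and $|\zeta-1|=r$ exists, and $\zeta$ is the unique $n$th root of unity with $|\zeta-1|=r$ and $\mathrm{Im}(\zeta)>0$. *)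

(* Defs.v *)
From HB Require Import structures.
From mathcomp Require Import all_boot all_order all_algebra all_field.
From mathcomp Require Import classical_sets reals.
From mathcomp Require Import complex.

Set Implicit Arguments.
Unset Strict Implicit.
Unset Printing Implicit Defensive.

Import Order.TTheory GRing.Theory Num.Theory.

Local Open Scope ring_scope.
Local Open Scope complex_scope.
Local Open Scope classical_set_scope.

(* [Normc.normc] is the modulus with values in [R]; the norm [`|z|] of [R[i]]
   is [(normc z)%:C]. *)
Definition upper_root_dists (R : realType) (n : nat) : set R :=
  [set Normc.normc (w - 1) | w in [set w : R[i] | w ^+ n = 1 /\ 0 < complex.Im w]].

Arguments upper_root_dists R n : clear implicits.

Definition is_minimum (R : realType) (A : set R) (r : R) : Prop :=
  A r /\ lbound A r.

(* Primitive roots in the sense of [n.-primitive_root] (exact order [n]) are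
   those whose powers w, w^2, ..., w^n are all the n-th roots of unity. *)
Lemma primitive_root_powersP (R : realType) (n : nat) (w : R[i]) :
  (0 < n)%N ->
  n.-primitive_root w <->
  (forall z : R[i], z ^+ n = 1 <-> exists2 k, (1 <= k <= n)%N & z = w ^+ k).
Proof.
move=> n_gt0; split=> [prim_w z|w_all].
  split=> [/(prim_rootP prim_w)[[k ltkn] /= ->]|[k _ ->]]; last first.
    by rewrite exprAC (prim_expr_order prim_w) expr1n.
  case: k ltkn => [|k] ltkn; last by exists k.+1; rewrite //= ltnW.
  by exists n; rewrite ?n_gt0 ?leqnn ?(prim_expr_order prim_w).
have wn1 : w ^+ n = 1 by apply/w_all; exists 1%N; rewrite ?expr1 // n_gt0.
have [m prim_w m_dv_n] := prim_order_exists n_gt0 wn1.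
suff -> : n = m by [].
apply/eqP; rewrite eqn_leq (dvdn_leq n_gt0 m_dv_n) andbT.
have [s Ds] := closed_field_poly_normal ('X^n - 1 : {poly R[i]}).
have monXn := monicXnsubC (1 : R[i]) n_gt0.
rewrite (monicP monXn) scale1r in Ds.
have szs : size s = n.
  by apply: succn_inj; rewrite -(size_prod_XsubC s id) -Ds size_XnsubC.
have uniqs : uniq s.
  rewrite -separable_prod_XsubC -Ds separable_Xn_sub_1 //.
  by rewrite pnatr_eq0 -lt0n.
have sz_m : size ('X^m - 1 : {poly R[i]}) = m.+1.
  by rewrite size_XnsubC // (prim_order_gt0 prim_w).
rewrite -ltnS -szs -sz_m max_poly_roots // -?size_poly_eq0 ?sz_m //.
apply/allP=> z zs; apply/rootP; rewrite !hornerE.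
have zn1 : z ^+ n = 1.
  have : root ('X^n - 1) z by rewrite Ds root_prod_XsubC.
  by move/rootP; rewrite !hornerE => /eqP; rewrite subr_eq0 => /eqP.
have [k _ ->] := (w_all z).1 zn1.
by rewrite exprAC (prim_expr_order prim_w) expr1n subrr.
Qed.

(* Main.v *)
Require Import Defs.
From mathcomp Require Import all_boot all_order all_algebra.
From mathcomp Require Import classical_sets reals.
From mathcomp Require Import complex.
From mathcomp Require Import ring lra.

Set Implicit Arguments.
Unset Strict Implicit.
Unset Printing Implicit Defensive.

Import Order.TTheory GRing.Theory Num.Theory.

Local Open Scope ring_scope.
Local Open Scope complex_scope.

(** On the unit circle [|w - 1|^2 = 2 - 2 Re w], so minimizing the distance to
    [1] means maximizing the real part: [zeta] has the largest real part among
    the [n]-th roots of unity other than [1] (the roots in the lower half plane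
    are covered by conjugation).

    By [primitive_root_powersP] it then suffices that every [n]-th root of
    unity [z] is a power of [zeta].
    Instead of comparing arguments, choose in the finite coset [z <zeta>] an
    element [u] of largest real part.  Neither [u * zeta] nor [u / zeta] has a
    larger real part than [u], which confines [u] to the sector of half-angle
    [arg zeta / 2] around [1] ([rotation_maximal_Re]).  A root of unity other
    than [1] in that sector would have a real part larger than that of [zeta],
    so [u = 1] and [z] is the inverse of a power of [zeta]. *)

Lemma unity_root_circle (R : rcfType) (n : nat) (w : R[i]) :
  (0 < n)%N -> w ^+ n = 1 -> complex.Re w ^+ 2 + complex.Im w ^+ 2 = 1.
Proof.
move=> n_gt0 wn1; apply: (@complexI R); rewrite add_Re2_Im2.
have /eqP : `|w| ^+ n = 1 by rewrite -normrX wn1 normr1.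
by rewrite pexpr_eq1 // => /eqP ->; rewrite expr1n.
Qed.

Lemma normc_sub1_circle (R : rcfType) (w : R[i]) :
  complex.Re w ^+ 2 + complex.Im w ^+ 2 = 1 ->
  Normc.normc (w - 1) ^+ 2 = 2 - 2 * complex.Re w.
Proof.
case: w => x y /= circ; rewrite sqr_sqrtr ?addr_ge0 ?sqr_ge0 //; nra.
Qed.

(** Only roots in the upper half plane compete in the minimum.  Conjugation
    carries the comparison to the lower one, and the only real root left is
    [-1], which is where [0 < Re zeta] comes in. *)
Lemma nearest_unity_root_Re (R : realType) (n : nat) (r : R) (zeta w : R[i]) :
  (0 < n)%N -> is_minimum (upper_root_dists R n) r ->
  zeta ^+ n = 1 -> Normc.normc (zeta - 1) = r ->
  0 < complex.Re zeta ->
  w ^+ n = 1 -> w != 1 -> complex.Re w <= complex.Re zeta.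
Proof.
move=> n_gt0 [_ r_lb] zetan1 zeta_r a_gt0 wn1 w_neq1.
have upper v : v ^+ n = 1 -> 0 < complex.Im v ->
    complex.Re v <= complex.Re zeta.
  move=> vn1 v_upper.
  have : Normc.normc (zeta - 1) <= Normc.normc (v - 1).
    by rewrite zeta_r; apply: r_lb; exists v.
  have normc_ge0 (t : R[i]) : 0 <= Normc.normc t.
    by case: t => ? ? /=; apply: sqrtr_ge0.
  rewrite -(@ler_pXn2r _ 2) ?nnegrE ?normc_ge0 //.
  rewrite (normc_sub1_circle (unity_root_circle n_gt0 zetan1)).
  by rewrite (normc_sub1_circle (unity_root_circle n_gt0 vn1)); lra.
have [w_upper|w_lower|w_real] := ltrgtP 0 (complex.Im w).
- exact: upper.
- have := upper w^*; rewrite -rmorphXn wn1 rmorph1.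
  by case: (w) w_lower => x y /= ?; apply; rewrite ?oppr_gt0.
- have := unity_root_circle n_gt0 wn1.
  case: w w_real w_neq1 {wn1} => x y /= <-.
  rewrite eq_complex /= eqxx andbT => x_neq1 circ.
  have : (x - 1) * (x + 1) = 0 by ring: circ.
  by move/eqP; rewrite mulf_eq0 subr_eq0 (negPf x_neq1) /= => /eqP x_eqN1; lra.
Qed.

(** With [u = e^(i t)] and [zeta = e^(i s)], the hypotheses say
    [cos (t + s) <= cos t] and [cos (t - s) <= cos t], whence [|t| <= s / 2];
    the conclusion is [cos (s / 2) <= cos t], squared. *)
Lemma rotation_maximal_Re (R : realFieldType) (a b x y : R) :
  a ^+ 2 + b ^+ 2 = 1 -> x ^+ 2 + y ^+ 2 = 1 -> a < 1 -> 0 < b ->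
  x * a - y * b <= x -> x * a + y * b <= x ->
  0 < x /\ 1 + a <= 2 * x ^+ 2.
Proof.
move=> circ_ab circ_xy a_lt1 b_gt0 rotl rotr.
have x_ge0 : 0 <= x by nra.
have sq : (y * b) ^+ 2 <= (x * (1 - a)) ^+ 2 by nra.
have half : 1 + a <= 2 * x ^+ 2.
  rewrite -(@ler_pM2l _ (1 - a)) ?subr_gt0 //.
  have : (y * b) ^+ 2 = (1 - x ^+ 2) * (1 - a ^+ 2).
    have -> : 1 - x ^+ 2 = y ^+ 2 by lra.
    have -> : 1 - a ^+ 2 = b ^+ 2 by lra.
    by rewrite exprMn.
  nra.
have a_gtN1 : -1 < a by nra.
by split=> //; nra.
Qed.

Lemma coset_maximal_Re (R : rcfType) (n : nat) (zeta z : R[i]) :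
  (0 < n)%N -> zeta ^+ n = 1 ->
  exists k, forall j, complex.Re (z * zeta ^+ j) <= complex.Re (z * zeta ^+ k).
Proof.
move=> n_gt0 zetan1.
pose k0 := Ordinal n_gt0.
case: (@Order.TotalTheory.arg_maxP _ _ _ k0 xpredT
  (fun k : 'I_n => complex.Re (z * zeta ^+ k))) => // k _ k_max.
exists k => j; rewrite -(expr_mod j zetan1).
exact: (k_max (Ordinal (ltn_pmod j n_gt0))).
Qed.

Theorem theorem1 (R : realType) (n : nat) (r a b : R)
    (hn : (6 <= n)%N) (hn_even : ~~ odd n)
    (hr : is_minimum (upper_root_dists R n) r)
    (hroot : (a +i* b) ^+ n = 1)
    (ha : 0 < a < 1) (hb : 0 < b < 1)
    (hdist : Normc.normc ((a +i* b) - 1) = r) :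
  n.-primitive_root (a +i* b).
Proof.
have n_gt0 : (0 < n)%N by apply: leq_trans hn.
case/andP: ha => a_gt0 a_lt1; case/andP: hb => b_gt0 _.
set zeta := a +i* b in hroot hdist *.
have circ := unity_root_circle n_gt0 hroot.
have zetaV : conjc zeta * zeta = 1.
  apply/eqP; rewrite eq_complex /=; apply/andP.
  by split; apply/eqP; move: circ => /=; lra.
(* Dividing by [zeta] is moving inside the coset, to the exponent [k + n - 1]. *)
have conj_pow k : conjc zeta * zeta ^+ k = zeta ^+ (k + n.-1).
  have -> : conjc zeta = zeta ^+ n.-1.
    have zetaS : zeta * zeta ^+ n.-1 = 1 by rewrite -exprS prednK.
    by rewrite -[LHS]mulr1 -zetaS mulrA zetaV mul1r.
  by rewrite -exprD addnC.
apply/(primitive_root_powersP _ n_gt0) => z; split=> [zn1|[k _ ->]]; last first.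
  by rewrite exprAC hroot expr1n.
have [k k_max] := coset_maximal_Re z n_gt0 hroot.
set u := z * zeta ^+ k in k_max.
have un1 : u ^+ n = 1 by rewrite exprMn zn1 exprAC hroot expr1n mulr1.
have u1 : u = 1.
  apply/eqP; apply: contraT => u_neq1.
  have := nearest_unity_root_Re n_gt0 hr hroot hdist a_gt0 un1 u_neq1.
  have := k_max k.+1; rewrite exprSr mulrA -/u.
  have := k_max (k + n.-1)%N; rewrite -conj_pow mulrCA -/u.
  have := unity_root_circle n_gt0 un1.
  case: (u) => x y /= circ_u rotr rotl x_le_a.
  have [] := @rotation_maximal_Re _ a b x y circ circ_u a_lt1 b_gt0.
  - by [].
  - by move: rotr; lra.
  (* The bound [1 + a <= 2 a^2] amounts to [(2 a + 1) (1 - a) <= 0]. *)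
  by move=> x_gt0 half; exfalso; move: half; nra.
(* The inverse of [zeta ^+ k], with an exponent brought into [1 .. n]. *)
pose e := (n - k %% n)%N.
have k_lt := ltn_pmod k n_gt0.
exists e; first by rewrite subn_gt0 k_lt leq_subr.
have powV : zeta ^+ k * zeta ^+ e = 1.
  by rewrite -(expr_mod k hroot) -exprD subnKC // ltnW.
by rewrite -[LHS]mulr1 -powV mulrA -/u u1 mul1r.
Qed.
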